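(* Let $P(s)=\dfrac{s-z}{(s-p_1)(s-p_2)}$ with $z>0$, $\operatorname{Re}(p_1)>0$, $\operatorname{Re}(p_2)>0$, where $p_1,p_2$ are either both real or a complex conjugate pair. Then $$\theta_M^{PID}\le\frac{\pi}{2}.$$
   Context: Controllers: $K_{PID}(s)=k_p+k_i/s+k_d s$ with real coefficients (possibly zero). Stabilization (unity negative feedback): write the plant as $P=N_P/D_P$ with numerator and denominator polynomials exactly as displayed (no cancellation of common factors is performed) and a controller as $K=N_K/D_K$ with $N_K,D_K$ coprime real polynomials. For a nonzero complex number $c$, $K$ stabilizes $cP$ if $\deg(N_PN_K)\le\deg(D_PD_K)$ and the closed-loop characteristic polynomial $D_PD_K+cN_PN_K$ has degree $\deg(D_PD_K)$ and all its roots in the open left half-plane. Margin: $\theta_M^{PID}=\sup\{\eta\in[0,\pi]:\ \exists\text{ a PID controller stabilizing } e^{-j\theta}P\text{ for all }\theta\in(-\eta,\eta)\}$, where $j=\sqrt{-1}$; one and the same controller must work for the whole range of $\theta$. *)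

(* Defs.v *)
From mathcomp Require Import all_boot all_order all_algebra.
From mathcomp Require Import complex.
From mathcomp Require Import all_classical all_reals all_analysis.
Set Implicit Arguments.
Unset Strict Implicit.
Unset Printing Implicit Defensive.
Import Order.TTheory GRing.Theory Num.Theory.
Local Open Scope ring_scope.
Local Open Scope classical_set_scope.

(* A controller is an element of the field of real rational functions. *)
Definition is_PID (R : realType) (K : {fraction {poly R}}) : Prop :=
  exists kp ki kd : R,
    K = tofrac kp%:P + tofrac ki%:P / tofrac 'X + tofrac kd%:P * tofrac 'X.

Definition coprime_repr (R : realType) (K : {fraction {poly R}})
    (N D : {poly R}) : Prop :=
  [/\ D != 0, coprimep N D & K = tofrac N / tofrac D].

Definition cpoly (R : realType) (p : {poly R}) : {poly R[i]} :=
  map_poly (real_complex R) p.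

(* Closed loop of K with the plant c * NP / DP under unity negative feedback.
   NP and DP are kept as given, without cancelling common factors.
   Since [size] is the degree plus one (and 0 for the zero polynomial),
   degrees are compared through sizes. The coprime representation of K is
   unique up to a common nonzero real factor, which affects none of the
   conditions. *)
Definition stabilizes (R : realType) (K : {fraction {poly R}})
    (c : R[i]) (NP DP : {poly R[i]}) : Prop :=
  exists NK DK : {poly R}, coprime_repr K NK DK /\
    let chi := DP * cpoly DK + c *: (NP * cpoly NK) in
    [/\ (size (NP * cpoly NK)%R <= size (DP * cpoly DK)%R)%N,
        size chi = size (DP * cpoly DK)%R
      & forall s : R[i], root chi s -> complex.Re s < 0].

(* e^{-j theta} *)
Definition expNi (R : realType) (theta : R) : R[i] :=
  Complex (cos theta) (- sin theta).

(* The set contains 0 (its condition on theta is then void) and is bounded by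
   pi, so [sup] is the genuine supremum. *)
Definition theta_M_PID (R : realType) (NP DP : {poly R[i]}) : R :=
  sup [set eta : R | 0 <= eta <= pi /\
    exists K : {fraction {poly R}}, is_PID K /\
      forall theta : R, - eta < theta < eta ->
        stabilizes K (expNi theta) NP DP].

(* Main.v *)
(** Suppose one controller works on an interval reaching beyond pi/2; then it
    works for c = 1 and c = -j.  Write the characteristic polynomial as A + c B
    with A, B real, and a = p1 + p2, m = kp - z kd.  For c = -j the sums of the
    roots and of their inverses have negative real parts, i.e. a < m kd and
    0 < ki (z kp - ki); with a > 0 this forces kp, ki, kd, m to share one sign.
    For c = 1 the polynomial is a real cubic whose coefficients 1 + kd, m - a
    and - z ki must share one sign, which is then impossible.  If ki = 0 the
    loop has order two and c = -j alone gives a contradiction. *)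
Require Import Defs.
From mathcomp Require Import all_boot all_order all_algebra.
From mathcomp Require Import complex polyrcf.
From mathcomp Require Import all_classical all_reals all_analysis.
From mathcomp Require Import ring lra.
Import Order.TTheory GRing.Theory Num.Theory.
Local Open Scope ring_scope.

(** * Coefficient inequalities for polynomials whose roots lie in the open left half-plane *)

Definition hurwitz {R : realType} (p : {poly R[i]}) : Prop :=
  forall s : R[i], root p s -> complex.Re s < 0.

Lemma complex_sqr_gt0 {R : realType} (w : R[i]) :
  w != 0 -> 0 < complex.Re w ^+ 2 + complex.Im w ^+ 2.
Proof.
move=> w0; rewrite lt_def addr_ge0 ?sqr_ge0 // andbT paddr_eq0 ?sqr_ge0 //.
by rewrite !sqrf_eq0; move: w0; rewrite eq_complex.
Qed.

Lemma hurwitz_normal {R : realType} (p : {poly R[i]}) (n : nat) :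
  size p = n.+2 -> hurwitz p ->
  exists rs : seq R[i],
    [/\ size rs = n.+1, (forall r, r \in rs -> complex.Re r < 0),
        lead_coef p != 0 & p = lead_coef p *: \prod_(r <- rs) ('X - r%:P)].
Proof.
move=> sp hp; have [rs prs] := closed_field_poly_normal p.
have l0 : lead_coef p != 0 by rewrite lead_coef_eq0 -size_poly_eq0 sp.
exists rs; split=> //.
- by move: sp; rewrite prs size_scale // size_prod_XsubC => -[].
- by move=> r rin; apply: hp; rewrite prs rootZ // root_prod_XsubC.
Qed.

(* Up to a positive factor this is Re (p_1 / p_0), and
   p_1 / p_0 = - \sum_r 1 / r over the roots r of p. *)
Lemma hurwitz_coef01 {R : realType} (p : {poly R[i]}) (n : nat) :
  size p = n.+2 -> hurwitz p -> 0 < complex.Re (p`_1 * conjc p`_0).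
Proof.
move=> sp hp; have [rs [srs hrs l0 ->]] := hurwitz_normal p n sp hp.
set q := \prod_(r <- rs) _.
have : q`_0 != 0 /\ 0 < complex.Re (q`_1 * conjc q`_0).
  rewrite {}/q; elim: rs n srs hrs {sp} => [//|r rs IH] [|n] srs hrs.
    case: rs srs {IH} hrs => // _ hrs.
    have := hrs r; rewrite inE eqxx => /(_ isT).
    rewrite big_seq1 !coefE /= subr0 sub0r => hr; split.
      by rewrite oppr_eq0; apply: contraTneq hr => ->; rewrite ltxx.
    by case: r hr {hrs} => x y /= hr; lra.
  have hr : complex.Re r < 0 by apply: hrs; rewrite inE eqxx.
  have [] := IH n; first by case: srs.
    by move=> s srs'; apply: hrs; rewrite inE srs' orbT.
  rewrite big_cons; set q := \prod_(j <- rs) _ => q0 q1.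
  have r0 : r != 0 by apply: contraTneq hr => ->; rewrite ltxx.
  (* For [('X - r) * q] the quantity becomes [- Re r * |q_0|^2 + |r|^2 * Re (q_1 * conj q_0)]; [h1]
     and [h2] below are the positivity of the two terms. *)
  rewrite !mulrBl !coefB !coefXM !coefCM /= sub0r; split.
    by rewrite oppr_eq0 mulf_neq0.
  move: q`_0 q`_1 q0 q1 => [a b] [c d] q0 q1.
  have ab : 0 < a ^+ 2 + b ^+ 2.
    exact: complex_sqr_gt0 q0.
  case: r hr r0 {hrs srs} => x y /= hr r0.
  have xy : 0 < x ^+ 2 + y ^+ 2 by nra.
  have h1 : 0 < - x * (a ^+ 2 + b ^+ 2) by rewrite mulr_gt0 // oppr_gt0.
  move: q1 => /= q1.
  have h2 : 0 < (x ^+ 2 + y ^+ 2) * (c * a + d * b).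
    by rewrite mulr_gt0 //; lra.
  nra.
(* The leading coefficient only contributes its squared modulus. *)
move=> [_ q1]; rewrite !coefZ.
move: q`_0 q`_1 (lead_coef p) l0 q1 => [a b] [c d] [x y] l0 /= q1.
have xy : 0 < x ^+ 2 + y ^+ 2.
  exact: complex_sqr_gt0 l0.
have := mulr_gt0 xy q1; nra.
Qed.

(** By Vieta the ratio of the two top coefficients is minus the sum of the roots; multiplying by the
    squared modulus of the leading one keeps the sign of the real part. *)
Lemma hurwitz_coef_top {R : realType} (p : {poly R[i]}) (n : nat) :
  size p = n.+2 -> hurwitz p -> 0 < complex.Re (p`_n * conjc p`_n.+1).
Proof.
move=> sp hp; have [rs [srs hrs l0 pE]] := hurwitz_normal p n sp hp.
have -> : p`_n.+1 = lead_coef p by rewrite lead_coefE sp.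
have -> : p`_n = lead_coef p * - \sum_(r <- rs) r.
  rewrite {1}pE coefZ -coefPn_prod_XsubC ?srs //.
have : complex.Re (\sum_(r <- rs) r) < 0.
  elim: rs n srs hrs {sp pE} => [//|r rs IH] [|n] srs hrs.
    by case: rs srs {IH} hrs => // _ hrs; rewrite big_seq1 hrs // inE eqxx.
  have hr : complex.Re r < 0 by apply: hrs; rewrite inE eqxx.
  have : complex.Re (\sum_(j <- rs) j) < 0.
    apply: (IH n); first by case: srs.
    by move=> s srs'; apply: hrs; rewrite inE srs' orbT.
  rewrite big_cons; case: r hr {srs hrs} => x y /= hx.
  by case: (\sum_(j <- rs) j) => u v /= hu; lra.
case: (\sum_(r <- rs) r) => u v /= hu.
move: (lead_coef p) l0 => [x y] l0 /=.
have xy : 0 < x ^+ 2 + y ^+ 2.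
  exact: complex_sqr_gt0 l0.
have : 0 < (x ^+ 2 + y ^+ 2) * - u by rewrite mulr_gt0 // oppr_gt0.
nra.
Qed.

Lemma coef_cpoly {R : realType} (p : {poly R}) (k : nat) :
  (cpoly p)`_k = real_complex R p`_k.
Proof. by rewrite coef_map. Qed.

Lemma hurwitz_quarter_turn {R : realType} (A B : {poly R}) (n : nat)
    (p := cpoly A + expNi (pi / 2) *: cpoly B) :
  size p = n.+2 -> hurwitz p ->
  0 < A`_1 * A`_0 + B`_1 * B`_0 /\ 0 < A`_n * A`_n.+1 + B`_n * B`_n.+1.
Proof.
move=> sp hp.
have := hurwitz_coef01 p n sp hp; have := hurwitz_coef_top p n sp hp.
rewrite /p !coefD !coefZ !coef_cpoly /expNi cos_pihalf sin_pihalf /=.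
by move=> h1 h2; split; nra.
Qed.

Lemma hurwitz_real {R : realType} (q : {poly R}) (n : nat) :
  size q = n.+2 -> hurwitz (cpoly q) -> 0 < q`_0 * q`_n.+1 /\ 0 < q`_n * q`_n.+1.
Proof.
move=> sq hq.
have sc : size (cpoly q) = n.+2 by rewrite size_map_poly.
split; last first.
  by have := hurwitz_coef_top _ n sc hq; rewrite !coef_cpoly /=; lra.
(* A positive leading coefficient and [f(0) <= 0] would give a real root in [[0, +oo[] by the
   intermediate value theorem. *)
have noroot (f : {poly R}) : size f = n.+2 -> hurwitz (cpoly f) ->
    0 < lead_coef f -> 0 < f`_0.
  move=> sf hf lf; rewrite ltNge; apply/negP => f0.
  have [M hM] := poly_pinfty_gt_lc lf.
  have [] := @poly_ivt _ f 0 (Num.max M 0).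
  - by rewrite le_max lexx orbT.
  - rewrite horner_coef0 f0 /=.
    by apply: le_trans (ltW lf) (hM _ _); rewrite le_max lexx.
  - move=> x /andP[x0 _] rx; have := hf (real_complex R x).
    by rewrite fmorph_root => /(_ rx) /=; rewrite ltNge x0.
have lE : lead_coef q = q`_n.+1 by rewrite lead_coefE sq.
have : lead_coef q != 0 by rewrite lead_coef_eq0 -size_poly_eq0 sq.
rewrite neq_lt => /orP[ln|lp].
- have : 0 < (- q)`_0.
    apply: noroot; rewrite ?size_polyN ?lead_coefN ?oppr_gt0 // => s.
    by rewrite /cpoly rmorphN rootN; exact: hq.
  by rewrite coefN oppr_gt0 -lE => q0; rewrite nmulr_rgt0.
- by rewrite -lE mulr_gt0 // noroot.
Qed.

(** * Coprime representations of a PID controller *)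

Lemma pid_clear_denominators {F : fieldType} (p i k x n d : F) :
  d != 0 -> x != 0 -> p + i / x + k * x = n / d ->
  n * x = d * (k * x ^+ 2 + p * x + i).
Proof.
move=> d0 x0 e; have -> : n = n / d * d by rewrite divfK.
by rewrite -e; field.
Qed.

(** Cross-multiplying and using coprimality, [DK] divides ['X]: it is a multiple of ['X] or a
    constant, and a constant forces [ki = 0]. *)
Lemma pid_coprime_repr {R : realType} (kp ki kd : R) (NK DK : {poly R}) :
  coprime_repr (tofrac kp%:P + tofrac ki%:P / tofrac 'X
                + tofrac kd%:P * tofrac 'X) NK DK ->
  exists2 l : R, l != 0 &
    (DK = l *: 'X /\ NK = l *: (kd *: 'X^2 + kp *: 'X + ki%:P)) \/
    [/\ ki = 0, DK = l%:P & NK = l *: (kd *: 'X + kp%:P)].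
Proof.
move=> [D0 cop KE].
have X0 : ('X : {poly R}) != 0 by rewrite polyX_eq0.
have cross : NK * 'X = DK * (kd *: 'X^2 + kp *: 'X + ki%:P).
  apply/eqP; rewrite -tofrac_eq; apply/eqP.
  have D0' : tofrac DK != 0 by rewrite tofrac_eq0.
  have X0' : tofrac ('X : {poly R}) != 0 by rewrite tofrac_eq0.
  have QE : tofrac (kd *: 'X^2 + kp *: 'X + ki%:P) =
      tofrac kd%:P * tofrac 'X ^+ 2 + tofrac kp%:P * tofrac 'X + tofrac ki%:P.
    by rewrite -!mul_polyC 2!tofracD expr2 2!tofracM (tofracM kp%:P 'X).
  by rewrite 2!tofracM QE (pid_clear_denominators _ _ _ _ _ _ D0' X0' KE).
have DX : DK %| 'X.
  by rewrite -(Gauss_dvdpr _ (_ : coprimep DK NK)) 1?coprimep_sym // cross dvdp_mulr.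
have [s1|s1] := boolP (size DK == 1).
  have /size_poly1P[l l0 DE] := s1; exists l => //; right.
  have ki0 : ki = 0.
    have := congr1 (fun p : {poly R} => p`_0) cross.
    rewrite /= coefMX /= DE coefCM !coefE /= => /esym/eqP.
    by rewrite !mulr0 !add0r mulf_eq0 (negbTE l0) => /eqP.
  split=> //; apply: (mulIf X0); rewrite cross DE ki0 -!mul_polyC polyC0; ring.
have : DK %= 'X.
  by have [_] := irredp_XsubC (0 : R); rewrite subr0; apply.
move=> /eqpP[[u v] /= /andP[u0 v0] uv].
have DE : DK = (v / u) *: 'X.
  by rewrite mulrC -scalerA -uv scalerA mulVf // scale1r.
exists (v / u); first by rewrite mulf_neq0 ?invr_eq0.
left; split=> //; apply: (mulIf X0); rewrite cross DE -!mul_polyC; ring.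
Qed.

(** The common factor [l] scales the characteristic polynomial and changes neither its degree nor
    its roots, so explicit numerators and denominators suffice. *)
Lemma stabilizes_pid {R : realType} (kp ki kd : R) (c : R[i]) (N D : {poly R}) :
  stabilizes (tofrac kp%:P + tofrac ki%:P / tofrac 'X
              + tofrac kd%:P * tofrac 'X) c (cpoly N) (cpoly D) ->
  let closed_loop NK DK := cpoly (D * DK) + c *: cpoly (N * NK) in
  let stable NK DK := size (closed_loop NK DK) = size (D * DK)
                      /\ hurwitz (closed_loop NK DK) in
  stable (kd *: 'X^2 + kp *: 'X + ki%:P) 'X \/
  ki = 0 /\ stable (kd *: 'X + kp%:P) 1.
Proof.
move=> [NK [DK [/pid_coprime_repr[l l0 NDK] [_ schi hchi]]]] cl st.
have scale NK' DK' : NK = l *: NK' -> DK = l *: DK' -> st NK' DK'.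
  move=> NE DE; move: schi hchi.
  have l0' : real_complex R l != 0 by rewrite fmorph_eq0.
  have -> : cpoly D * cpoly DK + c *: (cpoly N * cpoly NK)
      = real_complex R l *: cl NK' DK'.
    rewrite /cl /cpoly -!rmorphM NE DE -!scalerAr /= !map_polyZ /=.
    by rewrite scalerDr !scalerA (mulrC c).
  rewrite {1}/cpoly -rmorphM /= size_map_poly DE -scalerAr !size_scale // => sE hE.
  by split=> // s rs; apply: hE; rewrite rootZ.
case: NDK => [[DE NE]|[ki0 DE NE]]; [left|right; split=> //]; apply: scale => //.
by rewrite DE -mul_polyC mulr1.
Qed.

(** * Signs of the gains, and the contradiction between angles 0 and pi/2 *)

Variant gain_signs_spec {R : realType} (z kp kd : R) : Prop :=
  | GainsPos of 0 < kd & 0 < kp & 0 < kp - z * kd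
  | GainsNeg of kd < 0 & kp < 0 & kp - z * kd < 0.

(** The product [(kp - z * kd) * kd] is positive, so both factors share a sign, which passes to
    [kp = (kp - z * kd) + z * kd]. *)
Lemma gain_signs {R : realType} (z a kp kd : R) :
  0 < z -> 0 < a -> a < (kp - z * kd) * kd -> gain_signs_spec z kp kd.
Proof.
move=> z0 a0 h; have h0 := lt_trans a0 h.
have [kdn|kdp|kd0] := ltrgtP kd 0; last by move: h0; rewrite kd0 mulr0 ltxx.
- have mn : kp - z * kd < 0 by rewrite -(nmulr_lgt0 _ kdn).
  by right=> //; have : z * kd < 0; [rewrite pmulr_rlt0|lra].
- have mp : 0 < kp - z * kd by rewrite -(pmulr_lgt0 _ kdp).
  by left=> //; have : 0 < z * kd; [rewrite pmulr_rgt0|lra].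
Qed.

Lemma pid_not_stable_quarter_turn {R : realType} (z a b kp ki kd : R)
    (K := tofrac kp%:P + tofrac ki%:P / tofrac 'X + tofrac kd%:P * tofrac 'X)
    (N := 'X - z%:P : {poly R}) (D := 'X^2 - a *: 'X + b%:P) :
  0 < z -> 0 < a -> 0 < b ->
  stabilizes K (expNi 0) (cpoly N) (cpoly D) ->
  stabilizes K (expNi (pi / 2)) (cpoly N) (cpoly D) -> False.
Proof.
move=> z0 a0 b0 /stabilizes_pid st0 /stabilizes_pid st1.
set Q3 := kd *: 'X^2 + kp *: 'X + ki%:P in st0 st1.
set Q2 := kd *: 'X + kp%:P in st0 st1.
have e0 : expNi (0 : R) = 1 by rewrite /expNi cos0 sin0 oppr0.
have ND3 : N * Q3 = kd *: 'X^3 + (kp - z * kd) *: 'X^2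
                    + (ki - z * kp) *: 'X - (z * ki)%:P.
  rewrite /N /Q3 -!mul_polyC; ring.
have ND2 : N * Q2 = kd *: 'X^2 + (kp - z * kd) *: 'X - (z * kp)%:P.
  rewrite /N /Q2 -!mul_polyC; ring.
have DD3 : D * 'X = 'X^3 - a *: 'X^2 + b *: 'X.
  rewrite /D -!mul_polyC; ring.
have sD : size D = 3.
  rewrite /D -addrA size_polyDl ?size_polyXn //.
  apply: leq_ltn_trans (size_polyD _ _) _; rewrite gtn_max size_polyN.
  rewrite (leq_ltn_trans (size_scale_leq _ _)) ?size_polyX //.
  by rewrite (leq_ltn_trans (size_polyC_leq1 _)).
have sDX : size (D * 'X) = 4 by rewrite size_mulX ?sD // -size_poly_eq0 sD.
case: st1 => [[s1 h1]|[ki0 [s1 h1]]]; last first.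
  have [] := hurwitz_quarter_turn _ _ 1 (etrans s1 _) h1.
    by rewrite mulr1 sD.
  (* [f1] reads [a * b + z * kp * (kp - z * kd) < 0], yet both terms turn out positive. *)
  rewrite ND2 mulr1 /D !coefE /= => f1 f2.
  have mkd : a < (kp - z * kd) * kd by lra.
  have ab : 0 < a * b by rewrite mulr_gt0.
  have : 0 < z * (kp * (kp - z * kd)).
    have [_ ? ?|_ ? ?] := gain_signs z a kp kd z0 a0 mkd.
      by rewrite !mulr_gt0.
    by rewrite pmulr_rgt0 // nmulr_rgt0.
  lra.
have [] := hurwitz_quarter_turn _ _ 2 (etrans s1 sDX) h1.
rewrite ND3 DD3 !coefE /= => f1 f2.
(* [f1] reads [0 < z * ki * (z * kp - ki)], which excludes [ki = 0] and hence the order-two loop at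
   angle 0. *)
case: st0 => [[s0 h0]|[ki0 _]]; last by move: f1; rewrite ki0; lra.
have clE : cpoly (D * 'X) + expNi 0 *: cpoly (N * Q3) = cpoly (D * 'X + N * Q3).
  by rewrite e0 scale1r /cpoly rmorphD.
rewrite clE sDX in s0 h0.
have [] := hurwitz_real (D * 'X + N * Q3) 2 _ h0.
  by move: s0; rewrite size_map_poly.
rewrite ND3 DD3 !coefE /= => g1 g2.
have mkd : a < (kp - z * kd) * kd by lra.
have kiP : 0 < ki * (z * kp - ki) by rewrite -(pmulr_rgt0 _ z0); lra.
have {}g1 : ki * (1 + kd) < 0 by rewrite -(pmulr_rlt0 _ z0); lra.
have {}g2 : 0 < (kp - z * kd - a) * (1 + kd) by lra.
(* By [kiP], [ki] lies strictly between 0 and [z * kp]. If all signs are positive, [g1] would need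
   [1 + kd < 0]; if negative, [g1] gives [1 + kd > 0], and [g2] then needs [kp - z * kd > a > 0]. *)
have [kdp kpp mp|kdn kpn mn] := gain_signs z a kp kd z0 a0 mkd.
- have zkp : 0 < z * kp by rewrite mulr_gt0.
  have ki0 : 0 < ki by nra.
  by move: g1; rewrite pmulr_rlt0 //; lra.
- have zkp : z * kp < 0 by rewrite pmulr_rlt0.
  have ki0 : ki < 0 by nra.
  have kd1 : 0 < 1 + kd by rewrite -(nmulr_rlt0 _ ki0).
  move: g2; rewrite pmulr_lgt0 //; lra.
Qed.

Theorem corollary4p2 (R : realType) (z : R) (p1 p2 : R[i])
    (hz : 0 < z)
    (hp1 : 0 < complex.Re p1) (hp2 : 0 < complex.Re p2)
    (hp : (complex.Im p1 = 0 /\ complex.Im p2 = 0) \/ p2 = conjc p1) :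
  theta_M_PID ('X - (real_complex R z)%:P) (('X - p1%:P) * ('X - p2%:P))
    <= pi / 2.
Proof.
(* Sum and product of the poles are positive reals; for a conjugate pair the product is [|p1|^2]. *)
have [a [b [a0 b0 DE]]] : exists a b : R, [/\ 0 < a, 0 < b &
    ('X - p1%:P) * ('X - p2%:P) = cpoly ('X^2 - a *: 'X + b%:P)].
  have [b b0 bE] : exists2 b : R, 0 < b & p1 * p2 = real_complex R b.
    case: p1 p2 hp1 hp2 hp => x1 y1 [x2 y2] /= h1 h2 [[-> ->]|[-> ->]].
      exists (x1 * x2); first exact: mulr_gt0.
      by apply/eqP; rewrite eq_complex /= !mulr0 !mul0r subr0 addr0 !eqxx.
    exists (x1 ^+ 2 + y1 ^+ 2); first by nra.
    by apply/eqP; rewrite eq_complex /=; apply/andP; split; apply/eqP; ring.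
  have [a a0 aE] : exists2 a : R, 0 < a & p1 + p2 = real_complex R a.
    exists (complex.Re p1 + complex.Re p2); first exact: addr_gt0.
    case: p1 p2 hp {hp1 hp2 bE} => x1 y1 [x2 y2] /= [[-> ->]|[-> ->]];
      by apply/eqP; rewrite eq_complex /=; apply/andP; split; apply/eqP; ring.
  exists a, b; split=> //.
  rewrite /cpoly rmorphD rmorphB /= map_polyXn map_polyZ /= map_polyX map_polyC /=.
  rewrite -[(a%:C)%C]aE -[(b%:C)%C]bE -!mul_polyC; ring.
have NE : 'X - (real_complex R z)%:P = cpoly ('X - z%:P).
  by rewrite /cpoly rmorphB /= map_polyX map_polyC.
rewrite DE NE /theta_M_PID; apply: ge_sup.
  (* The supremum bound needs a nonempty set: [eta = 0] belongs to it with the zero controller, its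
     range of angles being empty. *)
  exists 0; split; first by rewrite lexx pi_ge0.
  exists 0; split; first by exists 0, 0, 0; rewrite !tofrac0 !mul0r !addr0.
  by move=> theta /andP[t1 t2]; move: (lt_trans t1 t2); rewrite oppr0 ltxx.
move=> eta [_ [K [[kp [ki [kd ->]]] st]]].
rewrite leNgt; apply/negP => heta.
have pi0 := pi_gt0 R.
apply: (pid_not_stable_quarter_turn z a b kp ki kd) => //; apply: st; lra.
Qed.
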